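(* Let $A$ be a finite set with $|A|\geq 3$, let $k\geq 2$ be an integer, and let $\varrho$ and $\sigma$ be two distinct central relations on $A$ such that $T_\varrho=\emptyset$. Then $\mathrm{Pol}_k\,\varrho \subseteq \mathrm{Pol}_k\,\sigma$ if and only if $2k\leq \mathrm{ar}(\varrho)<\mathrm{ar}(\sigma)\leq |A|-1$, $Z_\varrho=Z_\sigma$, and $T_\sigma=\emptyset$.
   Context: For a relation $\varrho\subseteq A^h$, $\mathrm{ar}(\varrho)=h$ denotes its arity. A $k$-ary operation $f:A^k\to A$ preserves $\varrho$ if, whenever $\bar x_1,\dots,\bar x_k\in\varrho$, the $h$-tuple $f(\bar x_1,\dots,\bar x_k)$ obtained by applying $f$ coordinatewise belongs to $\varrho$. $\mathrm{Pol}_k\,\varrho$ is the set of all $k$-ary operations on $A$ preserving $\varrho$. Central relations: A unary relation $\varrho\subseteq A$ is central if $\emptyset\neq\varrho\neq A$. A relation $\varrho\subseteq A^h$ with $h\geq 2$ is central if $\varrho\neq A^h$ and: it is totally symmetric ($(x_1,\dots,x_h)\in\varrho$ implies $(x_{\pi(1)},\dots,x_{\pi(h)})\in\varrho$ for all permutations $\pi$); it is totally reflexive ($(x_1,\dots,x_h)\in\varrho$ whenever $x_i=x_j$ for some $i\neq j$); and it has at least one central element, where $c\in A$ is a central element of $\varrho$ if $(c,x_2,\dots,x_h)\in\varrho$ for all $x_2,\dots,x_h\in A$. $Z_\varrho$ denotes the set of all central elements of $\varrho$ (for unary $\varrho$, $Z_\varrho=\varrho$). $T_\varrho$ denotes the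 set of all tuples $(x_1,\dots,x_h)\in\varrho$ such that $x_1,\dots,x_h$ are pairwise distinct non-central elements (so $T_\varrho=\emptyset$ if $\varrho$ is unary). *)

(* Defs.v *)
From mathcomp Require Import all_boot all_fingroup.

Set Implicit Arguments.
Unset Strict Implicit.
Unset Printing Implicit Defensive.

(* Finitary relations of positive arity: [Tagged _ R] with
   [R : {set h.+1.-tuple A}] has arity [h.+1]; relations of different arities
   are thus comparable, and distinct. *)
Definition relation (A : finType) := {h : nat & {set h.+1.-tuple A}}.

Definition ar (A : finType) (rho : relation A) : nat := (tag rho).+1.

Definition tuples (A : finType) (rho : relation A) : {set (ar rho).-tuple A} :=
  tagged rho.

Definition operation (A : finType) (k : nat) := {ffun k.-tuple A -> A}.

Definition apply_coordwise (A : finType) (k h : nat) (f : operation A k)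
    (X : k.-tuple (h.-tuple A)) : h.-tuple A :=
  [tuple f [tuple tnth (tnth X i) j | i < k] | j < h].

Definition preserves (A : finType) (k : nat) (f : operation A k)
    (rho : relation A) : bool :=
  [forall X : k.-tuple ((ar rho).-tuple A),
     [forall i, tnth X i \in tuples rho] ==>
       (apply_coordwise f X \in tuples rho)].

Definition Pol (A : finType) (k : nat) (rho : relation A) :
    {set operation A k} :=
  [set f | preserves f rho].

(* In arity 1 this is the set of [a] with [[tuple a]] in the relation. *)
Definition Z (A : finType) (rho : relation A) : {set A} :=
  [set c | [forall x : (tag rho).-tuple A, [tuple of c :: x] \in tuples rho]].

Definition T (A : finType) (rho : relation A) : {set (ar rho).-tuple A} :=
  [set x in tuples rho | uniq x && [forall i, tnth x i \notin Z rho]].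

Definition totally_symmetric (A : finType) (rho : relation A) : Prop :=
  forall (x : (ar rho).-tuple A) (p : {perm 'I_(ar rho)}),
    x \in tuples rho ->
    [tuple tnth x (p i) | i < ar rho] \in tuples rho.

Definition totally_reflexive (A : finType) (rho : relation A) : Prop :=
  forall (x : (ar rho).-tuple A) (i j : 'I_(ar rho)),
    i != j -> tnth x i = tnth x j -> x \in tuples rho.

Definition central (A : finType) (rho : relation A) : Prop :=
  if ar rho == 1 then tuples rho != set0 /\ tuples rho != setT
  else [/\ tuples rho != setT, totally_symmetric rho, totally_reflexive rho
         & exists c, c \in Z rho].

(* Main.v *)
(* When T rho is empty, rho consists of the tuples with a repeated or a central
   entry; call the remaining tuples free.  If 2k <= ar rho and k rows of length
   ar sigma are all non-free, then two bad columns per row, at most 2k columns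
   in all, already witness this, so ar rho columns suffice: this gives the
   inclusion.  Conversely, for y outside sigma and a matrix with distinct
   columns and rows in sigma, consider the operation sending the j-th column to
   y_j and everything else to a central element of rho.  It does not preserve
   sigma, hence not rho, and so some ar rho columns form a submatrix with rows
   in rho while the corresponding entries of y are free.  Matrices with all rows
   equal show that the non-members of sigma are exactly the tuples free for rho;
   copies of y with one bad entry or pair per row give 2k <= ar rho. *)
Require Import Defs.
From mathcomp Require Import all_boot all_fingroup zify.

Set Implicit Arguments.
Unset Strict Implicit.
Unset Printing Implicit Defensive.

Section Central.
Variable A : finType.
Implicit Types (r rho sigma : relation A) (C : {set A}).

(** * Membership in a central relation and free tuples *)

Definition holds r (x : 'I_(ar r) -> A) : bool := [tuple x j | j < ar r] \in tuples r.

(** Tuples are functions on ordinals here, so that selecting columns along [t] is the composition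
    with [t]. *)
Definition free C n (x : 'I_n -> A) : Prop :=
  injective x /\ forall j, x j \notin C.

Lemma free_comp C m n (x : 'I_n -> A) (t : 'I_m -> 'I_n) :
  injective t -> free C x -> free C (x \o t).
Proof. by move=> tI [xI xC]; split; [exact: inj_comp xI tI | move=> j; apply: xC]. Qed.

Lemma replace_inj n (y : 'I_n -> A) a c :
  injective y -> (forall j, y j != c) ->
  injective (fun j => if j == a then c else y j).
Proof.
move=> yI yc i j; case: eqP => [->|_]; case: eqP => [-> //|_].
- by move/esym/eqP; rewrite (negPf (yc j)).
- by move/eqP; rewrite (negPf (yc i)).
exact: yI.
Qed.

Lemma holds_eq r (x y : 'I_(ar r) -> A) : x =1 y -> holds x = holds y.
Proof. by move=> exy; rewrite /holds (eq_mktuple _ exy). Qed.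

Lemma in_tuplesE r (x : (ar r).-tuple A) : (x \in tuples r) = holds (tnth x).
Proof.
rewrite /holds; congr (_ \in tuples r).
by apply: eq_from_tnth => j; rewrite tnth_mktuple.
Qed.

Lemma ar1_ord_eq r (i j : 'I_(ar r)) : ar r = 1 -> i = j.
Proof.
by move: (ar r) i j => n i j n1; move: i j; rewrite n1 => i j; rewrite !ord1.
Qed.

Lemma in_tuples_head r (x : (ar r).-tuple A) :
  tnth x ord0 \in Z r -> x \in tuples r.
Proof.
rewrite inE => /forallP/(_ [tuple of behead x]); congr (_ \in tuples r).
by apply: val_inj; case: x => [[|a s] //= ss]; rewrite (tnth_nth a).
Qed.

Lemma holds_Z r (x : 'I_(ar r) -> A) j : central r -> x j \in Z r -> holds x.
Proof.
rewrite /central; case: ifP => [/eqP r1 _ xZ | _ [_ sym _ _] xZ].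
  apply: in_tuples_head; rewrite tnth_mktuple.
  by rewrite (ar1_ord_eq ord0 j r1).
pose p := tperm ord0 j.
have : [tuple x (p i) | i < ar r] \in tuples r.
  by apply: in_tuples_head; rewrite tnth_mktuple tpermL.
move/(sym _ p); congr (_ \in tuples r); apply: eq_from_tnth => i.
by rewrite !tnth_mktuple tpermK.
Qed.

Lemma holds_repeat r (x : 'I_(ar r) -> A) i j :
  central r -> i != j -> x i = x j -> holds x.
Proof.
rewrite /central; case: ifP => [/eqP r1 _ | _ [_ _ refl _]] ij xij.
  by rewrite (ar1_ord_eq i j r1) eqxx in ij.
by apply: (refl _ i j) => //; rewrite !tnth_mktuple.
Qed.

Lemma not_holds_free r (x : 'I_(ar r) -> A) :
  central r -> ~~ holds x -> free (Z r) x.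
Proof.
move=> cr nx; split=> [i j xij | j].
  by apply/eqP; apply: contraNT nx => ij; apply: holds_repeat xij.
by apply: contraNN nx; apply: holds_Z.
Qed.

(** A free tuple in [r] would be an element of [T r]. Together with [not_holds_free], the
    non-members of [r] are then exactly the free tuples. *)
Lemma T0_free r (x : 'I_(ar r) -> A) :
  T r = set0 -> free (Z r) x -> ~~ holds x.
Proof.
move=> T0 [xI xZ]; apply/negP => hx.
have : [tuple x j | j < ar r] \in T r.
  rewrite inE; apply/and3P; split; first exact: hx.
    by rewrite map_inj_uniq // enum_uniq.
  by apply/forallP => j; rewrite tnth_mktuple.
by rewrite T0 inE.
Qed.

Lemma central_Z r : central r -> exists c, c \in Z r.
Proof.
rewrite /central; case: ifP => [/eqP r1 [/set0Pn[x xr] _] | _ [] //].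
exists (tnth x ord0); rewrite inE; apply/forallP => u; move: xr; congr (_ \in tuples r).
by apply: eq_from_tnth => j; rewrite (ar1_ord_eq j ord0 r1).
Qed.

Lemma central_not_holds r : central r -> exists x : 'I_(ar r) -> A, ~~ holds x.
Proof.
move=> cr; have : tuples r != setT by move: cr; rewrite /central; case: ifP => _ [].
rewrite -subTset => /subsetPn[x _ xr]; exists (tnth x).
by rewrite -in_tuplesE.
Qed.

Lemma relation_ext r r' C :
  (forall x : 'I_(ar r) -> A, ~~ holds x <-> free C x) ->
  (forall x : 'I_(ar r') -> A, ~~ holds x <-> free C x) ->
  ar r = ar r' -> r = r'.
Proof.
case: r r' => [h R] [h' R'] hR hR' [/= e]; subst h'; congr existT.
apply/setP => x; apply: negb_inj.
have := hR (tnth x); have := hR' (tnth x); rewrite -!in_tuplesE /tuples /=.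
by move=> h1 h2; apply/idP/idP => [/h2/h1 | /h1/h2].
Qed.

(** * Preservation and the selection of columns *)

Lemma preservesP k r (f : operation A k) :
  reflect (forall M : 'I_k -> 'I_(ar r) -> A, (forall i, holds (M i)) ->
             holds (fun j => f [tuple M i j | i < k]))
          (preserves f r).
Proof.
apply: (iffP forallP) => [fr M hM | fr X].
  have /implyP := fr [tuple [tuple M i j | j < ar r] | i < k]; rewrite in_tuplesE.
  have hX : [forall i, tnth [tuple [tuple M i j | j < ar r] | i < k] i \in tuples r].
    by apply/forallP => i; rewrite tnth_mktuple; apply: hM.
  move/(_ hX); congr is_true; apply: holds_eq => j; rewrite tnth_mktuple; congr (f _).
  by apply: eq_from_tnth => i; rewrite !tnth_mktuple.
apply/implyP => /forallP hX; rewrite in_tuplesE.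
have hX' i : holds (tnth (tnth X i)) by rewrite -in_tuplesE.
by have := fr _ hX'; congr is_true; apply: holds_eq => j; rewrite tnth_mktuple.
Qed.

Lemma Pol_sub_columns k rho sigma (y : 'I_(ar sigma) -> A)
    (M : 'I_k -> 'I_(ar sigma) -> A) :
  central rho -> Pol k rho \subset Pol k sigma ->
  ~~ holds y -> (forall i, holds (M i)) ->
  (forall a b, (forall i, M i a = M i b) -> a = b) ->
  exists t : 'I_(ar rho) -> 'I_(ar sigma),
    [/\ injective t, free (Z rho) (y \o t) & forall i, holds (M i \o t)].
Proof.
move=> crho sub ny hM colI; have [c cZ] := central_Z crho.
pose col j := [tuple M i j | i < k].
(* The columns of [M] are distinct by [colI], so [pick] can only return the intended index. *)
pose f : operation A k :=
  [ffun x => if [pick j | col j == x] is Some j then y j else c].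
have fcol j : f (col j) = y j.
  rewrite ffunE; case: pickP => [a /eqP e | /(_ j)]; last by rewrite eqxx.
  congr (y _); apply: colI => i; have := congr1 (fun u => tnth u i) e.
  by rewrite !tnth_mktuple.
have : ~~ preserves f rho.
  apply: contraNN ny => frho; have := subsetP sub f; rewrite !inE => /(_ frho).
  by move/preservesP/(_ M hM); rewrite (holds_eq fcol).
case/forallPn => X; rewrite negb_imply => /andP[/forallP hX].
rewrite in_tuplesE => /(not_holds_free crho)[fI fZ].
(* A column of [X] foreign to [M] would be sent to [c], but the image of [X] has no central
   entry. *)
have /fin_all_exists[t ht] j : exists a, col a = [tuple tnth (tnth X i) j | i < k].
  have := fZ j; rewrite tnth_mktuple ffunE; case: pickP => [a /eqP | _].
    by exists a.
  by rewrite cZ.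
have yt j : y (t j) = tnth (apply_coordwise f X) j by rewrite -fcol ht tnth_mktuple.
exists t; split=> [a b tab | | i].
- by apply: fI; rewrite -!yt tab.
- by split=> [a b /= | j /=]; rewrite !yt; [apply: fI | apply: fZ].
have := hX i; rewrite in_tuplesE; congr is_true; apply: holds_eq => j /=.
by have := congr1 (fun u => tnth u i) (ht j); rewrite !tnth_mktuple.
Qed.

(** * Sufficiency of the conditions *)

Lemma injective_cover n h (B : {set 'I_n}) : #|B| <= h -> h <= n ->
  exists2 t : 'I_h -> 'I_n, injective t & forall b, b \in B -> exists j, t j = b.
Proof.
(* With [B] listed first, the first [h] entries of [e] cover it. *)
move=> Bh hn; pose e := enum B ++ enum (~: B).
have ue : uniq e.
  rewrite cat_uniq !enum_uniq andbT /=; apply/hasPn => x.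
  by rewrite !mem_enum inE.
have se : size e = n by rewrite size_cat -!cardE cardsC card_ord.
case: n => [|n] in B Bh hn e ue se *.
  by exists (widen_ord hn) => [a | []] //; have := ltn_ord a; lia.
exists (fun j => nth ord0 e j) => [a b /eqP | b bB].
  by rewrite nth_uniq // ?se; [move/eqP/val_inj
    | exact: leq_trans (ltn_ord a) hn | exact: leq_trans (ltn_ord b) hn].
have ib : index b e < h.
  apply: leq_trans Bh; rewrite /e index_cat mem_enum bB cardE.
  by rewrite index_mem mem_enum.
by exists (Ordinal ib); rewrite nth_index // mem_cat mem_enum bB.
Qed.

Lemma Pol_sub_of_arity k rho sigma :
  central rho -> central sigma -> T sigma = set0 -> T rho = set0 ->
  Z rho = Z sigma -> 2 * k <= ar rho -> ar rho <= ar sigma ->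
  Pol k rho \subset Pol k sigma.
Proof.
move=> crho csigma Ts Tr eZ kr rs; apply/subsetP => f; rewrite !inE => frho.
apply/preservesP => M hM; apply: contraTT isT => /(not_holds_free csigma) ffree.
(* These are the bad columns of row [i]; for a central entry only the first component matters. *)
have /fin_all_exists[p hp] i : exists p : 'I_(ar sigma) * 'I_(ar sigma),
    (p.1 != p.2) && (M i p.1 == M i p.2) || (M i p.1 \in Z sigma).
  apply/existsP; apply/existsPn => Mfree.
  have /(T0_free Ts) : free (Z sigma) (M i); last by rewrite hM.
  split=> [a b /eqP ab | a]; have := Mfree (a, _); last first.
    by move/(_ a); rewrite eqxx.
  by move/(_ b); rewrite /= ab andbT negb_or negbK => /andP[/eqP].
pose B := [set (p i).1 | i : 'I_k] :|: [set (p i).2 | i : 'I_k].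
have cB : #|B| <= ar rho.
  apply: leq_trans kr; rewrite mul2n -addnn (leq_trans (leq_card_setU _ _)) //.
  by apply: leq_add; rewrite (leq_trans (leq_imset_card _ _)) // card_ord.
have [t tI tB] := injective_cover cB rs.
have hMt i : holds (M i \o t : 'I_(ar rho) -> A).
  have [|a ta] := tB (p i).1; first by rewrite inE (imset_f (fun i => (p i).1)).
  have [|b tb] := tB (p i).2; first by rewrite inE orbC (imset_f (fun i => (p i).2)).
  case/orP: (hp i) => [/andP[ne /eqP e] | pZ].
    apply: (@holds_repeat _ _ a b) => //=; rewrite ?ta ?tb //.
    by apply: contraNneq ne => ab; rewrite -ta -tb ab.
  by apply: (@holds_Z _ _ a) => //=; rewrite ta eZ.
move/preservesP/(_ _ hMt): frho; apply: contraTT => _; apply: T0_free => //.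
by rewrite eZ; apply: (free_comp tI ffree).
Qed.

(** * Consequences of the inclusion *)

Section Inclusion.
Variables (k : nat) (rho sigma : relation A).
Hypotheses (k_gt1 : 1 < k) (crho : central rho) (csigma : central sigma).
Hypotheses (Trho : T rho = set0) (sub : Pol k rho \subset Pol k sigma).

Lemma not_holds_sigmaE (y : 'I_(ar sigma) -> A) :
  ~~ holds y <-> free (Z rho) y.
Proof.
have k0 := ltn_trans (ltn0Sn 0) k_gt1.
split=> [ny | yfree].
  have [yI yZ] := not_holds_free csigma ny; split=> // a; apply/negP => ya.
  have [c cZ] := central_Z csigma.
  (* The columns selected from copies of [x] avoid [a], where [y] is central for [rho]; there [x]
     agrees with [y], so the rows would be free. *)
  pose x j := if j == a then c else y j.
  have xI : injective x.
    by apply: replace_inj => // j; apply: contraNneq (yZ j) => ->.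
  have hx : holds x by apply: (@holds_Z _ _ a); rewrite // /x eqxx.
  have [t [_ yt /(_ (Ordinal k0))]] := Pol_sub_columns (M := fun=> x) crho sub ny
    (fun=> hx) (fun a b e => xI _ _ (e (Ordinal k0))).
  rewrite (@holds_eq _ _ (y \o t)) ?(negPf (T0_free Trho yt)) // => j /=.
  by rewrite /x; case: eqP => // e; have := yt.2 j; rewrite /= e ya.
apply/negP => hy; have [x nx] := central_not_holds csigma.
have [t [tI _ /(_ (Ordinal k0))]] := Pol_sub_columns (M := fun=> y) crho sub nx
  (fun=> hy) (fun a b e => yfree.1 _ _ (e (Ordinal k0))).
by apply/negP/(T0_free Trho)/free_comp.
Qed.

(** Any application of [Pol_sub_columns] gives an injection between the index sets; copies of a
    non-member with one entry made central provide the matrix. *)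
Lemma Pol_sub_arity_le : ar rho <= ar sigma.
Proof.
have [y ny] := central_not_holds csigma; have [c cZ] := central_Z csigma.
have [yI yZ] := not_holds_free csigma ny.
pose x j := if j == ord0 then c else y j.
have xI : injective x.
  by apply: replace_inj => // j; apply: contraNneq (yZ j) => ->.
have hx : holds x by apply: (@holds_Z _ _ ord0); rewrite // /x eqxx.
have [t [tI _ _]] := Pol_sub_columns (M := fun=> x) crho sub ny
  (fun=> hx) (fun a b e => xI _ _ (e (Ordinal (ltnW k_gt1)))).
by have := leq_card t tI; rewrite !card_ord.
Qed.

Lemma Pol_sub_Z : Z rho = Z sigma.
Proof.
apply/setP => z; apply/idP/idP => zZ.
  rewrite inE; apply/forallP => x; rewrite in_tuplesE.
  by apply: contraLR zZ => /not_holds_sigmaE[_ /(_ ord0)].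
apply: contraTT isT => zrho; have [y ny] := central_not_holds csigma.
have [_ yZs] := not_holds_free csigma ny; have [yI yZr] := (not_holds_sigmaE y).1 ny.
(* This tuple is free for [rho], hence outside [sigma], although [z] is central for [sigma]. *)
pose x j := if j == ord0 then z else y j.
have : free (Z rho) x.
  split=> [|j]; last by rewrite /x; case: eqP.
  by apply: replace_inj => // j; apply: contraNneq (yZs j) => ->.
by move/not_holds_sigmaE; rewrite (@holds_Z _ _ ord0) // /x eqxx.
Qed.

Lemma Pol_sub_T : T sigma = set0.
Proof.
apply/setP => x; rewrite !inE in_tuplesE; apply/negP => /and3P[hx ux /forallP xZ].
have /not_holds_sigmaE : free (Z rho) (tnth x); last by rewrite hx.
by split; [apply/tuple_uniqP | rewrite Pol_sub_Z].
Qed.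

Lemma Pol_sub_arity_lt : rho <> sigma -> ar rho < ar sigma.
Proof.
move=> neq; rewrite ltn_neqAle Pol_sub_arity_le andbT; apply/eqP => e; apply: neq.
(* In equal arity both relations would have the same non-members. *)
apply: (relation_ext (C := Z rho)) e; last exact: not_holds_sigmaE.
by move=> x; split; [apply: not_holds_free | apply: T0_free].
Qed.

(* The bad columns of the i-th row are 2i and 2i+1, or just the last of the
   columns 0, ..., ar rho when these are out of range.  Together they exhaust
   these ar rho + 1 columns as soon as ar rho < 2k. *)
Lemma Pol_sub_arity_ge : ar rho < ar sigma -> 2 * k <= ar rho.
Proof.
move=> rs; rewrite leqNgt; apply/negP => rk.
have [y ny] := central_not_holds csigma; have [c cZ] := central_Z csigma.
have [yI yZ] := not_holds_free csigma ny.
have yc j : y j != c by apply: contraNneq (yZ j) => ->.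
set h := ar rho in rs rk *.
pose p (i : 'I_k) : 'I_(ar sigma) := inord (minn (2 * i) h).
pose q (i : 'I_k) : 'I_(ar sigma) := inord (2 * i).+1.
have pE i : p i = minn (2 * i) h :> nat.
  by rewrite inordK // -[(tag sigma).+1]/(ar sigma); lia.
have qE (i : 'I_k) : 2 * i < h -> q i = (2 * i).+1 :> nat.
  by move=> ih; rewrite inordK // -[(tag sigma).+1]/(ar sigma); lia.
pose M i j := if j == p i then (if 2 * i < h then y (q i) else c) else y j.
have hM i : holds (M i).
  have [ih | ih] := ltnP (2 * i) h.
    have pq : p i != q i by rewrite -(inj_eq val_inj) /= pE qE //; lia.
    apply: (holds_repeat csigma pq).
    by rewrite /M eqxx eq_sym (negPf pq) ih.
  by apply: (@holds_Z _ _ (p i)); rewrite // /M eqxx ltnNge ih.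
have M_eq i (a b : 'I_(ar sigma)) :
    a < b -> M i a = M i b -> a = 2 * i :> nat /\ b = (2 * i).+1 :> nat.
  rewrite /M => ab; have nab : a <> b by move=> e; rewrite e ltnn in ab.
  have := qE i; have := pE i; case: (ltnP (2 * i) h) => [ih pi /(_ isT) qi | _ _ _].
    case: eqP => [ea | _]; case: eqP => [eb | _].
    - by rewrite ea eb in nab.
    - by move/yI => e; rewrite -e ea; lia.
    - by move/yI => e; move: ab; rewrite e eb; lia.
    - by move/yI.
  case: eqP => [ea | _]; case: eqP => [eb | _].
  - by rewrite ea eb in nab.
  - by move/esym/eqP; rewrite (negPf (yc _)).
  - by move/eqP; rewrite (negPf (yc _)).
  - by move/yI.
(* Rows 0 and 1, available as [k] is at least 2, cannot repeat the same pair of columns. *)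
have colI a b : (forall i, M i a = M i b) -> a = b.
  move=> e; have k0 : 0 < k by lia.
  case: (ltngtP a b) => [ab | ba | /val_inj //].
    have := M_eq (Ordinal k0) _ _ ab (e _); have := M_eq (Ordinal k_gt1) _ _ ab (e _).
    by rewrite /=; lia.
  have := M_eq (Ordinal k0) _ _ ba (esym (e _)).
  have := M_eq (Ordinal k_gt1) _ _ ba (esym (e _)).
  by rewrite /=; lia.
have [t [tI yt hMt]] := Pol_sub_columns crho sub ny hM colI.
(* The image of [t] has only [h] elements, so it misses one of the columns 0, ..., [h]. *)
have [j jh jt] : exists2 j : 'I_(ar sigma), j <= h & forall a, t a != j.
  have : ~~ ([set j : 'I_(ar sigma) | j <= h] \subset [set t a | a : 'I_(ar rho)]).
    apply/negP => /subset_leq_card; rewrite card_imset // card_ord -/h.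
    apply/negP; rewrite -ltnNge.
    pose w (a : 'I_h.+1) := widen_ord rs a.
    have wI : injective w by move=> a b /(congr1 val) /= /val_inj.
    rewrite -[X in X <= _](card_ord h.+1) -(card_imset _ wI).
    apply/subset_leq_card/subsetP => _ /imsetP[a _ ->]; rewrite inE /=.
    by have := ltn_ord a; lia.
  case/subsetPn => j; rewrite inE => jh /imsetP jt; exists j => // a.
  by apply/eqP => e; apply: jt; exists a.
(* Column [j] is bad for row [j./2]; without it that row becomes free on the selected columns, hence
   leaves [rho]. *)
have jk : j./2 < k by lia.
pose i := Ordinal jk.
have := hMt i; apply/negP; apply: T0_free => //; have [ytI ytZ] := yt.
have pi := pE i; have qi := qE i.
have [pj | pj] := eqVneq (p i) j.
  have e : M i \o t =1 y \o t.
    by move=> a /=; rewrite /M pj (negPf (jt a)).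
  by split=> [a b | a]; rewrite !e; [apply: ytI | apply: ytZ].
have ih : 2 * i < h.
  by move: pj; rewrite -(inj_eq val_inj) /= pi /=; lia.
have qj : q i = j.
  by apply: val_inj; move: pj; rewrite -(inj_eq val_inj) /= pi qi //=; lia.
(* The overwritten entry is now [y j], which occurs at no other selected column. *)
split=> [a b | a] /=; rewrite /M ih qj.
  case: eqP => [ea | _]; case: eqP => [eb | _].
  - by move=> _; apply: tI; rewrite ea eb.
  - by move/yI/esym/eqP; rewrite (negPf (jt b)).
  - by move/yI/eqP; rewrite (negPf (jt a)).
  - by move/yI/tI.
by case: ifP => _; [rewrite Pol_sub_Z | apply: ytZ].
Qed.

End Inclusion.

(** * The upper bound on the arity and the equivalence *)

Lemma central_arity_lt r : central r -> ar r <= #|A| - 1.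
Proof.
move=> cr; have [x nx] := central_not_holds cr; have [c cZ] := central_Z cr.
have [xI xZ] := not_holds_free cr nx.
(* The entries of a non-member are distinct and all differ from the central element [c]. *)
have -> : #|A| - 1 = #|[set~ c]| by rewrite cardsC1 subn1.
rewrite -[X in X <= _](card_ord (ar r)) -(card_imset _ xI) subset_leq_card //.
apply/subsetP => _ /imsetP[j _ ->]; rewrite !inE.
by apply: contraNneq (xZ j) => ->.
Qed.

End Central.

Theorem theorem3p3 (A : finType) (k : nat) (rho sigma : relation A) :
  3 <= #|A| -> 2 <= k ->
  central rho -> central sigma -> rho <> sigma ->
  T rho = set0 ->
  Pol k rho \subset Pol k sigma <->
  [/\ 2 * k <= ar rho, ar rho < ar sigma, ar sigma <= #|A| - 1,
      Z rho = Z sigma & T sigma = set0].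
Proof.
move=> _ k_gt1 crho csigma neq Trho; split=> [sub | [kr rs _ eZ Tsigma]].
  have rs := Pol_sub_arity_lt k_gt1 crho csigma Trho sub neq.
  split=> //.
  - exact: Pol_sub_arity_ge rs.
  - exact: central_arity_lt.
  - exact: Pol_sub_Z sub.
  - exact: Pol_sub_T sub.
exact: Pol_sub_of_arity (ltnW rs).
Qed.
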